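(* Let $r \in \mathbb{Z}^+$, let $1 < q_1 \mid q_2 \mid \cdots \mid q_r$ be integers, put $\mathbf{q} = (q_1,\ldots,q_r)$, and suppose $G(\mathbf{q}) = \bigoplus_{j=1}^r \mathbb{Z}/q_j\mathbb{Z}$ is a finite commutative $p$-group for some prime $p$. Let $\{A_i\}_{i=1}^\infty$ be a sequence of finite nonempty subsets of $\mathbb{Z}$; for $1 \le j \le r$ let $B_j \subset \mathbb{Z}/q_j\mathbb{Z}$ be nonempty, and put $B = \prod_{j=1}^r B_j \subset G(\mathbf{q})$. Let $\mathcal{G}$ be a finite graph with vertex set $V = \{1,\ldots,r\}$ and edge set $E = \{1,\ldots,n\}$, $n\in\mathbb{Z}^+$; put $\mathbf{A} = \prod_{i=1}^n A_i$. Let $\underline{a} = (a^{(1)},\ldots,a^{(n)})$ be the incidence matrix of $\mathcal{G}$, viewed as a sequence of length $n$ in $G'(\mathbf{q})$. (a) The number of $B$-divisible $\mathbf{A}$-weighted subgraphs of $\mathcal{G}$ is $N_{\mathbf{A}}^B(\underline{a})$. (b) If each $A_i$ contains $0$ and at least one element not divisible by $q_r = \exp G(\mathbf{q})$, and each $B_j$ contains $0$, then there is a nonempty $\mathbf{A}$-weighted $B$-divisible subgraph of $\mathcal{G}$ whenever $n \ge D_{\mathbf{A}}^B(G'(\mathbf{q}))$. (c) Let $p$ be a prime, let $1 \le v_1 \le \ldots \le v_r$ be integers, and suppose $\mathbf{q} = (p^{v_1},\ldots,p^{v_r})$. Suppose that each of $A_1,\ldots,A_n,B_1,\ldots,B_r$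 has the property that no two distinct elements are congruent modulo $p$. Then: (i) The number of $\mathbf{A}$-weighted $B$-divisible subgraphs of $\mathcal{G}$ is either $0$ or at least $$\mathfrak{m}\Big(\# A_1,\ldots,\# A_n;\ \sum_{i=1}^n \# A_i - \sum_{j=1}^r (p^{v_j}-\# B_j)\Big).$$ (ii) Suppose that $0 \in A_i$ for all $1 \le i \le n$ and $0 \in B_j$ for all $1 \le j \le r$. Then there is a nonempty $\mathbf{A}$-weighted $B$-divisible subgraph of $\mathcal{G}$ if $$\sum_{i=1}^n (\# A_i - 1) > \sum_{j=1}^r (p^{v_j}-\# B_j).$$
   Context: A graph is a relation $\sim$ (incidence) between two finite sets $V$ (vertices) and $E$ (edges) such that every $e \in E$ is incident to exactly two elements of $V$; thus multiple edges are allowed and loops are not. The incidence matrix is given by $a^{(i)} = (a^{(i)}_1,\ldots,a^{(i)}_r)$ for $1\le i\le n$, where $a^{(i)}_j = 1$ if edge $i$ is incident to vertex $j$ and $a^{(i)}_j = 0$ otherwise; $a^{(i)}$ is viewed as an element of $G(\mathbf{q})$ by reducing coordinates. If $q_1$ is even, $G'(\mathbf{q})$ is the index $2$ subgroup of $G(\mathbf{q})$ given by the kernel of the homomorphism $G(\mathbf{q}) \to \mathbb{Z}/2\mathbb{Z}$, $(x^{(1)},\ldots,x^{(r)}) \mapsto \sum_j x^{(j)} \pmod 2$. If $q_1$ is odd, $G'(\mathbf{q}) = G(\mathbf{q})$. Since each edge is incident to exactly two vertices, each $a^{(i)}$ lies in $G'(\mathbf{q})$. An $\mathbf{A}$-weighted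 subgraph of $\mathcal{G}$ is an element $a = (a_1,\ldots,a_n) \in \mathbf{A}$, viewed as assigning the integer weight $a_i$ to edge $i$; it is nonempty if not all $a_i$ are $0$. The weighted degree of a vertex $j$ is $d_{\mathbf{A}}(j) = \sum_{i \sim j} a_i$, the sum of the weights of the edges incident to $j$. The weighted subgraph is $B$-divisible if for all $1 \le j \le r$ the class of $d_{\mathbf{A}}(j)$ in $\mathbb{Z}/q_j\mathbb{Z}$ lies in $B_j$. For a sequence $\underline{g} = (g_1,\ldots,g_n)$ in $G(\mathbf{q})$, $N_{\mathbf{A}}^B(\underline{g}) = \#\{a \in \prod_{i=1}^n A_i \mid \sum_{i=1}^n a_i g_i \in B\}$. When each $A_i$ (for all $i\ge 1$) contains $0$ and at least one element not divisible by the exponent of the group, and $0 \in B$, the fat Davenport constant $D_{\mathbf{A}}^B(G'(\mathbf{q}))$ is the least $m \in \mathbb{Z}^+$ such that for every sequence $g_1,\ldots,g_m$ in $G'(\mathbf{q})$ there are $a_i \in A_i$ ($1 \le i \le m$), not all $0$, with $\sum_{i=1}^m a_i g_i \in B$ (equivalently, in $B \cap G'(\mathbf{q})$). For $n,a_1,\ldots,a_n \in \mathbb{Z}^+$ and an integer $N \le \sum_{i=1}^n a_i$, put $\mathfrak{m}(a_1,\ldots,a_n;N) = 1$ if $N < n$, and, if $n \le N \le \sum_{i=1}^n a_i$, let $\mathfrak{m}(a_1,\ldots,a_n;N)$ be the minimum of $\prod_{i=1}^n y_i$ over all $(y_1,\ldots,y_n) \in \mathbb{Z}^n$ with $1 \le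 y_i \le a_i$ for all $i$ and $\sum_{i=1}^n y_i = N$. *)

(* Defs.v *)
From HB Require Import structures.
From mathcomp Require Import all_boot all_order all_algebra.
From mathcomp Require Import all_fingroup all_solvable finmap.
Set Implicit Arguments.
Unset Strict Implicit.
Unset Printing Implicit Defensive.
Import Order.TTheory GRing.Theory Num.Theory.
Local Open Scope ring_scope.

(* Z/q_1 (+) ... (+) Z/q_r. Since 'Z_k is the ring of integers mod (max k 2),
   this is the intended group only when 1 < q j for all j. *)
Definition Gq (r : nat) (q : 'I_r -> nat) : Type :=
  {dffun forall j : 'I_r, 'Z_(q j)}.

HB.instance Definition _ (r : nat) (q : 'I_r -> nat) := Finite.on (Gq q).

Definition Gq0 (r : nat) (q : 'I_r -> nat) : Gq q := [ffun j => 0].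
Definition GqN (r : nat) (q : 'I_r -> nat) (x : Gq q) : Gq q :=
  [ffun j => - x j].
Definition GqD (r : nat) (q : 'I_r -> nat) (x y : Gq q) : Gq q :=
  [ffun j => x j + y j].

Fact GqDA (r : nat) (q : 'I_r -> nat) : associative (@GqD r q).
Proof. by move=> x y z; apply/ffunP => j; rewrite !ffunE addrA. Qed.

Fact GqDC (r : nat) (q : 'I_r -> nat) : commutative (@GqD r q).
Proof. by move=> x y; apply/ffunP => j; rewrite !ffunE addrC. Qed.

Fact GqD0 (r : nat) (q : 'I_r -> nat) : left_id (Gq0 q) (@GqD r q).
Proof. by move=> x; apply/ffunP => j; rewrite !ffunE add0r. Qed.

Fact GqDN (r : nat) (q : 'I_r -> nat) :
  left_inverse (Gq0 q) (@GqN r q) (@GqD r q).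
Proof. by move=> x; apply/ffunP => j; rewrite !ffunE addNr. Qed.

HB.instance Definition _ (r : nat) (q : 'I_r -> nat) :=
  GRing.isZmodule.Build (Gq q) (@GqDA r q) (@GqDC r q) (@GqD0 r q) (@GqDN r q).
HB.instance Definition _ (r : nat) (q : 'I_r -> nat) :=
  [finGroupMixin of Gq q for +%R].

Definition Gq_prod (r : nat) (q : 'I_r -> nat)
    (B : forall j : 'I_r, {set 'Z_(q j)}) : {set Gq q} :=
  [set x : Gq q | [forall j, x j \in B j]].

(* When q_1 is even every q_j is even, so the parity of the sum of the canonical
   representatives x j in {0, ..., q_j - 1} is the value of the homomorphism
   to Z/2. *)
Definition Gq' (r : nat) (q : 'I_r.+1 -> nat) : {set Gq q} :=
  [set x : Gq q | odd (q ord0) || ~~ odd (\sum_(j < r.+1) (x j : nat))].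

(* The product A_1 x ... x A_n; the sequence (A_i) is indexed from 0. *)
Definition weighting (n : nat) (A : nat -> {fset int}) : finType :=
  {dffun forall i : 'I_n, A i}.

Definition weight (n : nat) (A : nat -> {fset int}) (a : weighting n A)
    (i : 'I_n) : int := val (a i).

Definition nonempty_weighting (n : nat) (A : nat -> {fset int})
    (a : weighting n A) : bool := [exists i, weight a i != 0].

Definition wsum (G : finZmodType) (n : nat) (A : nat -> {fset int})
    (g : 'I_n -> G) (a : weighting n A) : G := \sum_(i < n) g i *~ weight a i.

Definition Ncount (G : finZmodType) (n : nat) (A : nat -> {fset int})
    (B : {set G}) (g : 'I_n -> G) : nat :=
  #|[set a : weighting n A | wsum g a \in B]|.

Definition fat_davenport_prop (G : finZmodType) (A : nat -> {fset int})
    (B H : {set G}) (m : nat) : Prop :=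
  forall g : 'I_m -> G, (forall i, g i \in H) ->
  exists2 a : weighting m A, nonempty_weighting a & wsum g a \in B.

Definition is_fat_davenport (G : finZmodType) (A : nat -> {fset int})
    (B H : {set G}) (D : nat) : Prop :=
  [/\ (0 < D)%N, fat_davenport_prop A B H D &
      forall m, (0 < m)%N -> fat_davenport_prop A B H m -> (D <= m)%N].

(* In particular this applies when each A_i contains an element not divisible
   by the exponent, as such an element is nonzero. *)
Lemma fat_davenport_exists (G : finZmodType) (A : nat -> {fset int})
    (B H : {set G}) :
  (forall i, 0 \in A i) -> (forall i, exists2 x, x \in A i & x != 0) ->
  0 \in B -> exists D, is_fat_davenport A B H D.
Proof.
move=> A0 Anz B0.
pose Pb m := (0 < m)%N && [forall g : {ffun 'I_m -> G},
  [forall i, g i \in H] ==>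
  [exists a : weighting m A, nonempty_weighting a && (wsum g a \in B)]].
have PbP m : reflect ((0 < m)%N /\ fat_davenport_prop A B H m) (Pb m).
  apply: (iffP andP) => -[m0 Hm]; split=> //.
    move=> g gH; have /forallP/(_ (finfun g)) := Hm.
    have -> : [forall i, (finfun g) i \in H].
      by apply/forallP => i; rewrite ffunE.
    case/existsP => a /andP[a0 aB]; exists a => //.
    by move: aB; rewrite /wsum; under eq_bigr do rewrite ffunE.
  apply/forallP => g; apply/implyP => /forallP gH.
  by have [a a0 aB] := Hm g gH; apply/existsP; exists a; rewrite a0.
suff exP : exists m, Pb m.
  exists (ex_minn exP); case: ex_minnP => m /PbP[m0 Hm] minm; split=> // k k0 Hk.
  by apply: minm; apply/PbP.
exists #|G|; apply/PbP; split; first by apply/card_gt0P; exists 0.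
move=> g _.
have Anz' i : exists x : A i, val x != 0.
  by have [x xA x0] := Anz i; exists [` xA]%fset.
pose b i : A i := xchoose (Anz' i).
have b0 i : val (b i) != 0 by exact: (xchooseP (Anz' i)).
pose z i : A i := [` A0 i]%fset.
pose h (i : 'I_#|G|) := g i *~ val (b i).
pose s (k : 'I_(#|G|).+1) : G := \sum_(i < #|G| | (i < k)%N) h i.
have [k [l [ltkl eqs]]] : exists k l : 'I_(#|G|).+1, (k < l)%N /\ s k = s l.
  have /injectivePn[k [l nekl eqs]] : ~~ injectiveb s.
    apply/negP => /injectiveP /card_codom eqc.
    by have := max_card (mem (codom s)); rewrite eqc card_ord ltnn.
  case: (ltngtP k l) => [lt|lt|/val_inj eqkl].
  - by exists k, l.
  - by exists l, k.
  - by rewrite eqkl eqxx in nekl.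
pose a : weighting #|G| A :=
  [ffun i : 'I_#|G| => if (k <= i < l)%N then b i else z i].
have wE i : weight a i = if (k <= i < l)%N then val (b i) else 0.
  by rewrite /weight ffunE; case: ifP.
exists a.
  have ltk : (k < #|G|)%N by exact: leq_trans ltkl (ltn_ord l).
  apply/existsP; exists (Ordinal ltk); rewrite wE leqnn ltkl; exact: b0.
suff -> : wsum g a = 0 by [].
have -> : wsum g a = \sum_(i < #|G| | (k <= i < l)%N) h i.
  rewrite /wsum [RHS]big_mkcond; apply: eq_bigr => i _; rewrite wE.
  by case: ifP; rewrite ?mulr0z.
have sl : s l = s k + \sum_(i < #|G| | (k <= i < l)%N) h i.
  rewrite /s (bigID (fun i : 'I_#|G| => (i < k)%N)) /=; congr (_ + _).
    apply: eq_bigl => i; case: (ltnP i k) => [ik|]; rewrite ?andbF ?andbT //.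
    exact: ltn_trans ltkl.
  by apply: eq_bigl => i; rewrite -leqNgt andbC.
by apply: (addrI (s k)); rewrite -sl addr0.
Qed.

(* Multiple edges are allowed, loops are not. *)
Record graph (V E : finType) := Graph {
  incident : V -> E -> bool;
  card_incident : forall e, #|[set v | incident v e]| = 2%N }.

Definition incidence (r n : nat) (q : 'I_r -> nat)
    (G : graph 'I_r 'I_n) (i : 'I_n) : Gq q :=
  [ffun j => (incident G j i)%:R].

Lemma incidence_in_Gq' (r n : nat) (q : 'I_r.+1 -> nat)
    (G : graph 'I_r.+1 'I_n) (i : 'I_n) :
  (forall j, 1 < q j)%N -> incidence q G i \in Gq' q.
Proof.
move=> q1; rewrite inE; apply/orP; right.
have -> : \sum_(j < r.+1) (incidence q G i j : nat) = #|[set v | incident G v i]|.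
  rewrite -sum1_card [RHS]big_mkcond /=; apply: eq_bigr => j _.
  rewrite ffunE inE; case: (incident G j i) => //=.
by rewrite card_incident.
Qed.

Definition wdeg (r n : nat) (A : nat -> {fset int}) (G : graph 'I_r 'I_n)
    (a : weighting n A) (j : 'I_r) : int :=
  \sum_(i < n | incident G j i) weight a i.

Definition divisible (r n : nat) (q : 'I_r -> nat) (A : nat -> {fset int})
    (B : forall j : 'I_r, {set 'Z_(q j)}) (G : graph 'I_r 'I_n)
    (a : weighting n A) : bool :=
  [forall j, (wdeg G a j)%:~R \in B j].

(* Relevant for N <= \sum_i a i only. In the second branch the idle value
   \prod_i a i is harmless: it is an upper bound for all the products. *)
Definition minprod (n : nat) (a : 'I_n -> nat) (N : int) : nat :=
  if N < n%:Z then 1%N else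
  \big[minn/(\prod_(i < n) a i)%N]_(y : {dffun forall i : 'I_n, 'I_(a i).+1} |
      [forall i, 0 < y i]%N && (\sum_(i < n) (y i)%:Z == N))
    (\prod_(i < n) y i)%N.

(* Main.v *)
(* For part (c), write each condition "weighted degree of j lies in B_j" as the
   non-vanishing mod p of a combination of the binomials 'C(d(j), k) with
   k <= p^(v_j) - #B_j. On sets A_i of integers distinct mod p, such a binomial
   agrees with a polynomial over F_p of degree at most k in the weights, so the
   product over j of these combinations is a function on the grid \prod A_i, of
   degree at most \sum_j (p^(v_j) - #B_j), whose non-zeros are exactly the
   divisible weightings. The Alon-Furedi bound on the number of non-zeros of a
   polynomial on a grid then gives both (i) and (ii). *)
Require Import Defs.
From mathcomp Require Import all_boot all_order all_algebra.
From mathcomp Require Import all_fingroup all_solvable finmap zify.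
Import Order.TTheory GRing.Theory Num.Theory.
Local Open Scope ring_scope.

(** * Lagrange interpolation and its top coefficient *)

Section Interpolation.
Context {F : fieldType}.
Implicit Types (s : seq F) (h : F -> F).

Definition lagrange_weight s (x : F) : F := \prod_(y <- rem x s) (x - y)^-1.

(** The weights are kept apart from the monic products, so that the coefficient of degree
    [size s - 1] is the weighted sum of the values of [h]. *)
Definition lagrange_sum s h : {poly F} :=
  \sum_(x <- s) (h x * lagrange_weight s x) *: \prod_(y <- rem x s) ('X - y%:P).

Lemma lagrange_weight_neq0 s x : uniq s -> lagrange_weight s x != 0.
Proof.
move=> us; rewrite /lagrange_weight prodf_seq_neq0; apply/allP => y.
rewrite rem_filter // mem_filter /= => /andP[yx _].
by rewrite invr_eq0 subr_eq0 eq_sym.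
Qed.

Lemma size_lagrange_sum s h : (size (lagrange_sum s h) <= size s)%N.
Proof.
apply: (leq_trans (size_sum _ _ _)); apply/bigmax_leqP_seq => x xs _.
apply: (leq_trans (size_scale_leq _ _)).
by rewrite size_prod_XsubC size_rem // prednK //; case: (s) xs.
Qed.

Lemma lagrange_sum_eval s h : uniq s -> {in s, forall x, (lagrange_sum s h).[x] = h x}.
Proof.
move=> us x xs; rewrite horner_sum (bigD1_seq x) //= [X in _ + X]big1_seq ?addr0.
  rewrite hornerZ horner_prod -mulrA -big_split /= big1_seq ?mulr1 // => y /=.
  rewrite rem_filter // mem_filter /= => /andP[yx _].
  by rewrite !hornerE mulVf // subr_eq0 eq_sym.
move=> y /andP[yx ys]; rewrite hornerZ horner_prod (bigD1_seq x) ?rem_uniq //=.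
  by rewrite hornerXsubC subrr mul0r mulr0.
by rewrite rem_filter // mem_filter /= eq_sym yx.
Qed.

(* The sum is the coefficient of degree [size s - 1] of the interpolation
   polynomial, which is [Q] itself. *)
Lemma sum_lagrange_weight s (Q : {poly F}) : uniq s -> (size Q < size s)%N ->
  \sum_(x <- s) Q.[x] * lagrange_weight s x = 0.
Proof.
move=> us sQ.
have QE : lagrange_sum s (horner Q) = Q.
  apply/eqP; rewrite -subr_eq0; apply/eqP.
  apply: (@roots_geq_poly_eq0 _ _ s) => //.
    apply/allP => x xs; rewrite /root hornerD hornerN lagrange_sum_eval //.
    by rewrite subrr.
  apply: (leq_trans (size_polyD _ _)); rewrite geq_max size_lagrange_sum size_polyN.
  exact: ltnW.
have : Q`_(size s).-1 = 0 by rewrite nth_default // -ltnS prednK //; case: (s) sQ.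
rewrite -[in X in X -> _]QE coef_sum => {2}<-; apply: eq_big_seq => x xs.
rewrite coefZ; have := monic_prod_XsubC (rem x s) predT id.
rewrite monicE lead_coefE size_prod_XsubC size_rem //= => /eqP ->.
by rewrite mulr1.
Qed.

Lemma interpolation {T : eqType} (iota : T -> F) (A : seq T) (h : T -> F) :
  uniq A -> {in A &, injective iota} ->
  exists2 P : {poly F}, (size P <= size A)%N & {in A, forall a, P.[iota a] = h a}.
Proof.
move=> uA injA; pose k z := nth 0 (map h A) (index z (map iota A)).
exists (lagrange_sum (map iota A) k).
  by rewrite -(size_map iota); exact: size_lagrange_sum.
move=> a aA; rewrite lagrange_sum_eval ?map_inj_in_uniq ?map_f // /k.
have ltA : (index (iota a) (map iota A) < size A)%N.
  by rewrite -(size_map iota) index_mem map_f.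
rewrite (nth_map a) //; congr h; apply: injA; rewrite ?mem_nth //.
by rewrite -(nth_map _ 0) // nth_index // map_f.
Qed.

End Interpolation.

(** * Functions of bounded degree on a finite grid, and the Alon-Furedi bound *)

Section GridFunctions.
Context {F : fieldType} {T : eqType} (iota : T -> F).
Implicit Types (A : seq T) (As : seq (seq T)) (f g : seq T -> F).

Fixpoint grid As : seq (seq T) :=
  if As is A :: As' then [seq a :: x | a <- A, x <- grid As'] else [:: [::]].

(* On [grid As], [f] agrees with a polynomial of total degree at most [d] in the
   coordinates [iota (nth _ x i)]. *)
Fixpoint deg_le As (d : nat) f : Prop :=
  if As is A :: As' then
    exists2 c : nat -> seq T -> F,
      forall m, (m <= d)%N -> deg_le As' (d - m) (c m)
    & {in A, forall a, {in grid As', forall x,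
        f (a :: x) = \sum_(m < d.+1) c m x * iota a ^+ m}}
  else True.

Lemma mem_grid_cons A As a x :
  (a :: x \in grid (A :: As)) = (a \in A) && (x \in grid As).
Proof.
apply/allpairsP/andP => [[[b y] /= [bA yA [-> ->]]] //|[aA xA]].
by exists (a, x).
Qed.

Lemma mem_grid As (x : seq T) (t0 : T) :
  reflect (size x = size As /\
           forall i, (i < size As)%N -> nth t0 x i \in nth [::] As i)
          (x \in grid As).
Proof.
elim: As x => [|A As IH] [|a x].
- by apply: (iffP idP).
- by apply: (iffP idP) => [//|[]].
- apply: (iffP idP) => [|[]//].
  by case/allpairsP => -[b y] /= [].
rewrite mem_grid_cons; apply: (iffP andP) => [[aA /IH[sx xA]]|[[sx] xA]].
  by split=> [|[|i]] //=; [rewrite sx | exact: xA].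
by split; [exact: (xA 0%N) | apply/IH; split=> // i iA; exact: (xA i.+1)].
Qed.

Lemma uniq_grid As : all uniq As -> uniq (grid As).
Proof.
elim: As => //= A As IH /andP[uA uAs].
by apply: allpairs_uniq (IH uAs) _ => // -[a x] [b y] _ _ /= [-> ->].
Qed.

Lemma deg_le_ext As d f g : {in grid As, f =1 g} -> deg_le As d f -> deg_le As d g.
Proof.
case: As => //= A As fg [c cd fE]; exists c => // a aA x xA.
by rewrite -fg ?fE // -/(grid (A :: As)) mem_grid_cons aA.
Qed.

Lemma deg_le0 As d : deg_le As d (fun=> 0).
Proof.
elim: As d => //= A As IH d; exists (fun _ _ => 0) => [m _|a _ x _]; first exact: IH.
by rewrite big1 // => m _; rewrite mul0r.
Qed.

Lemma deg_leD As d f g :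
  deg_le As d f -> deg_le As d g -> deg_le As d (fun x => f x + g x).
Proof.
elim: As d f g => //= A As IH d f g [c cd fE] [c' cd' gE].
exists (fun m x => c m x + c' m x) => [m md|a aA x xA]; first by apply: IH; auto.
by rewrite fE // gE // -big_split; apply: eq_bigr => m _; rewrite mulrDl.
Qed.

Lemma deg_leZ As d k f : deg_le As d f -> deg_le As d (fun x => k * f x).
Proof.
elim: As d f => //= A As IH d f [c cd fE].
exists (fun m x => k * c m x) => [m md|a aA x xA]; first by apply: IH; auto.
by rewrite fE // mulr_sumr; apply: eq_bigr => m _; rewrite mulrA.
Qed.

Lemma deg_le_sum As d {I : Type} (r : seq I) (P : pred I) (f : I -> seq T -> F) :
  (forall i, P i -> deg_le As d (f i)) ->
  deg_le As d (fun x => \sum_(i <- r | P i) f i x).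
Proof.
move=> fd; elim: r => [|i r IH].
  by apply: deg_le_ext (deg_le0 As d) => x _; rewrite big_nil.
case: (boolP (P i)) => Pi; last first.
  by apply: deg_le_ext IH => x _; rewrite big_cons (negbTE Pi).
by apply: deg_le_ext (deg_leD _ _ _ _ (fd i Pi) IH) => x _; rewrite big_cons Pi.
Qed.

Lemma deg_leW As d e f : (d <= e)%N -> deg_le As d f -> deg_le As e f.
Proof.
elim: As d e f => //= A As IH d e f de [c cd fE].
exists (fun m x => if (m <= d)%N then c m x else 0) => [m me|a aA x xA].
  case: (leqP m d) => md; last exact: deg_le0.
  exact: IH (leq_sub2r m de) (cd m md).
rewrite fE // (big_ord_widen e.+1 (fun m => c m x * iota a ^+ m)) // big_mkcond.
by apply: eq_bigr => m _ /=; rewrite ltnS; case: leqP => //; rewrite mul0r.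
Qed.

(** Over each point of the remaining grid, multiply the two polynomials in the first coordinate: a
    term of the [m]-th coefficient pairs the degrees [d - i] and [e - (m - i)], which add up to
    [d + e - m]. *)
Lemma deg_leM As d e f g :
  deg_le As d f -> deg_le As e g -> deg_le As (d + e) (fun x => f x * g x).
Proof.
elim: As d e f g => //= A As IH d e f g [c cd fE] [c' cd' gE].
pose p x : {poly F} := \poly_(i < d.+1) c i x.
pose p' x : {poly F} := \poly_(i < e.+1) c' i x.
exists (fun m x => (p x * p' x)`_m) => [m mde|a aA x xA].
  apply: (deg_le_ext _ _ (fun x => \sum_(i < m.+1) (p x)`_i * (p' x)`_(m - i))).
    by move=> x _; rewrite coefM.
  apply: deg_le_sum => i _; have im : (i <= m)%N by rewrite -ltnS.
  case: (leqP i d) => id; last first.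
    by apply: deg_le_ext (deg_le0 _ _) => x _; rewrite coef_poly ltnS leqNgt id mul0r.
  case: (leqP (m - i) e) => ie; last first.
    apply: deg_le_ext (deg_le0 _ _) => x _.
    by rewrite [X in _ * X]coef_poly ltnS leqNgt ie mulr0.
  have -> : (d + e - m = (d - i) + (e - (m - i)))%N.
    by rewrite -[in LHS](subnKC im) subnDA addnC -addnBA // addnC addnBA.
  apply: deg_le_ext (IH _ _ _ _ (cd _ id) (cd' _ ie)) => x _.
  by rewrite !coef_poly !ltnS id ie.
rewrite fE // gE // -(horner_poly _ (c^~ x)) -(horner_poly _ (c'^~ x)) -hornerM.
apply: horner_coef_wide.
apply: (leq_trans (size_polyMleq _ _)).
by rewrite -subn1 leq_subLR add1n -addnS -addSn leq_add ?size_poly.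
Qed.

Lemma deg_le_prod As {I : Type} (r : seq I) (d : I -> nat) (f : I -> seq T -> F) :
  (forall i, deg_le As (d i) (f i)) -> deg_le As 0 (fun=> 1) ->
  deg_le As (\sum_(i <- r) d i) (fun x => \prod_(i <- r) f i x).
Proof.
move=> fd d1; elim: r => [|i r IH].
  by rewrite big_nil; apply: deg_le_ext d1 => x _; rewrite big_nil.
rewrite big_cons; apply: deg_le_ext (deg_leM _ _ _ _ _ (fd i) IH) => x _.
by rewrite big_cons.
Qed.

(** Adjoins a factor in the first coordinate alone: the coefficient of its [m]-th power is a
    multiple of [f], zero for [m > d], and [e <= d + e - m] otherwise. The 0 is a default for the
    empty list, which lies outside the grid. *)
Lemma deg_le_cons A As d e (h : T -> F) f (P : {poly F}) :
  (size P <= d.+1)%N -> {in A, forall a, h a = P.[iota a]} -> deg_le As e f ->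
  deg_le (A :: As) (d + e) (fun x => if x is a :: x' then h a * f x' else 0).
Proof.
move=> sP hP fe; exists (fun m x => P`_m * f x) => [m mde|a aA x xA] /=.
  case: (leqP m d) => md.
    by apply: deg_leZ; apply: deg_leW fe; rewrite addnC -addnBA // leq_addr.
  apply: deg_le_ext (deg_le0 _ _) => x _.
  by rewrite nth_default ?mul0r // (leq_trans sP).
rewrite hP // (@horner_coef_wide _ (d + e).+1) //; last first.
  by rewrite (leq_trans sP) // ltnS leq_addr.
by rewrite mulr_suml; apply: eq_bigr => m _; rewrite mulrAC.
Qed.

Lemma deg_le1 As : deg_le As 0 (fun=> 1).
Proof.
elim: As => // A As IH.
apply: deg_le_ext (deg_le_cons A As 0 0 (fun=> 1) (fun=> 1) 1 _ _ IH).
- by case=> [|a x]; [case/allpairsP => -[b y] /= [] | rewrite mulr1].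
- by rewrite size_poly1.
- by move=> a _; rewrite hornerC.
Qed.

(* The powers of the first coordinate are reduced modulo the polynomial vanishing
   on [A], so that fewer than [size A] of them remain. *)
Lemma deg_le_reduce A As d f : uniq A -> {in A &, injective iota} ->
  deg_le (A :: As) d f ->
  exists2 c : nat -> seq T -> F,
    forall m, if (m <= d)%N then deg_le As (d - m) (c m)
              else {in grid As, forall x, c m x = 0}
  & {in A, forall a, {in grid As, forall x,
      f (a :: x) = \sum_(m < size A) c m x * iota a ^+ m}}.
Proof.
move=> uA injA [c cd fE].
(* The bound [size A] caps the number of powers; the bound [k.+1] keeps the total degree from
   growing. *)
have /fin_all_exists[R RP] (k : 'I_d.+1) : exists R : {poly F},
    [/\ (size R <= size A)%N, (size R <= k.+1)%N
      & {in A, forall a, R.[iota a] = iota a ^+ k}].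
  case: (ltnP k (size A)) => kA.
    by exists 'X^k; rewrite size_polyXn; split=> // a _; rewrite hornerXn.
  have [R sR RE] := interpolation iota A (fun a => iota a ^+ k) uA injA.
  by exists R; split=> //; apply: leq_trans sR _; exact: leqW.
exists (fun m x => \sum_(k < d.+1) (R k)`_m * c k x) => [m|a aA x xA].
  case: leqP => md.
    apply: deg_le_sum => k _; have [_ sR _] := RP k.
    have kd : (k <= d)%N by rewrite -ltnS.
    case: (leqP m k) => mk.
      by apply: deg_leZ; apply: deg_leW (cd k kd); rewrite leq_sub2l.
    apply: deg_le_ext (deg_le0 _ _) => x _.
    by rewrite nth_default ?mul0r // (leq_trans sR).
  move=> x _; rewrite big1 // => k _; have [_ sR _] := RP k.
  by rewrite nth_default ?mul0r // (leq_trans sR) // (leq_trans (ltn_ord k)).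
rewrite fE //; under eq_bigr => k _.
  have [sR _ RE] := RP k.
  rewrite -RE // (horner_coef_wide _ sR) mulr_sumr; over.
rewrite exchange_big /=; apply: eq_bigr => m _; rewrite mulr_suml.
by apply: eq_bigr => k _; rewrite mulrA [c _ _ * _]mulrC.
Qed.

Lemma count_grid_cons A As (P : pred (seq T)) :
  count P (grid (A :: As)) = (\sum_(x <- grid As) count (fun a => P (a :: x)) A)%N.
Proof.
rewrite -sum1_count big_mkcond big_allpairs_dep exchange_big /=.
by apply: eq_bigr => x _; rewrite -sum1_count [RHS]big_mkcond.
Qed.

(** Induction on the coordinates. Let [m] be the largest power of the first coordinate whose reduced
    coefficient [c m] is nonzero somewhere on the remaining grid. Over each point where [c m] is
    nonzero, [f] is a polynomial of degree [m] in the first coordinate, hence has at least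
    [size A - m] nonzeros; [c m] has degree at most [d - m], so induction counts these points. *)
Lemma alon_furedi As d f :
  all uniq As -> {in As, forall A, {in A &, injective iota}} ->
  deg_le As d f -> has (fun x => f x != 0) (grid As) ->
  exists y : seq nat,
    [/\ all2 (fun k A => 0 < k <= size A)%N y As,
        (sumn (map size As) <= sumn y + d)%N
      & (\prod_(k <- y) k <= count (fun x => f x != 0%R) (grid As))%N].
Proof.
elim: As d f => [|A As IH] d f /=.
  by move=> _ _ _; rewrite orbF => fn0; exists [::]; rewrite big_nil fn0.
move=> /andP[uA uAs] injAs fd fn0.
have injA : {in A &, injective iota} by apply: injAs; rewrite mem_head.
have {}injAs : {in As, forall A, {in A &, injective iota}}.
  by move=> A' A'As; apply: injAs; rewrite inE A'As orbT.
have [c cd fE] := deg_le_reduce A As d f uA injA fd.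
pose nz m := has (fun x => c m x != 0) (grid As).
have [m0 m0A nzm0] : exists2 m, (m < size A)%N & nz m.
  have /hasP[_ /allpairsP[[a x] /= [aA xA ->]]] := fn0; rewrite fE // => sn0.
  have [m cn0] : exists m : 'I_(size A), c m x != 0.
    apply/existsP; apply: contraR sn0 => /existsPn c0; rewrite big1 // => m _.
    by have /eqP -> := negPn (c0 m); rewrite mul0r.
  by exists m => //; apply/hasP; exists x.
have nz_lt m : nz m && (m < size A)%N -> (m <= size A)%N by case/andP => _ /ltnW.
have exnz : exists m, nz m && (m < size A)%N by exists m0; rewrite nzm0.
have [m /andP[nzm mA] maxm] := ex_maxnP exnz nz_lt.
have md : (m <= d)%N.
  rewrite leqNgt; apply/negP => dm; have := cd m; rewrite leqNgt dm /= => cm0.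
  by have /hasP[x xA /eqP[]] := nzm; exact: cm0.
have := cd m; rewrite md => cmd.
have [y [yAs ys yP]] := IH _ _ uAs injAs cmd nzm.
exists ((size A - m)%N :: y); rewrite /= yAs subn_gt0 mA leq_subr; split=> //.
  by move: ys mA md; lia.
rewrite big_cons (count_grid_cons A As).
apply: (@leq_trans ((size A - m) * count (fun x => c m x != 0%R) (grid As))%N).
  by rewrite leq_mul2l yP orbT.
rewrite -sum1_count big_distrr /= big_mkcond big_seq [X in (_ <= X)%N]big_seq.
apply: leq_sum => x xA; case: ifP => // cn0; rewrite muln1.
(* By maximality of [m] the coefficients beyond [m] vanish at [x], so truncating there keeps the
   values of [f]. *)
pose Q : {poly F} := \poly_(k < m.+1) c k x.
have QE a : a \in A -> f (a :: x) = Q.[iota a].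
  move=> aA; rewrite fE // horner_poly.
  rewrite [RHS](big_ord_widen (size A) (fun k => c k x * iota a ^+ k)) //.
  rewrite [RHS]big_mkcond.
  apply: eq_bigr => k _ /=; case: ltnP => // mk.
  have : ~~ nz k by apply/negP => nzk; have := maxm k; rewrite nzk ltn_ord leqNgt mk => /(_ isT).
  by move/hasPn/(_ x xA)/negPn/eqP ->; rewrite mul0r.
(* It remains to see that [f] has at most [m] zeros over [x]: [iota] sends them to distinct roots of
   [Q], which is nonzero of size at most [m.+1]. *)
rewrite leq_subLR -[X in (X <= _)%N](count_predC (fun a => f (a :: x) != 0)) addnC leq_add2r.
rewrite -ltnS.
have Q0 : Q != 0 by apply: contraNneq cn0 => Q0; rewrite -(coef0 _ m) -Q0 coef_poly ltnSn.
apply: (leq_trans _ (size_poly m.+1 (c^~ x))).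
rewrite -size_filter -(size_map iota); apply: max_poly_roots => //.
  apply/allP => _ /mapP[a + ->]; rewrite mem_filter /= negbK => /andP[/eqP f0 aA].
  by rewrite /root -QE // f0.
have uiA : uniq (map iota A) by rewrite map_inj_in_uniq.
by rewrite (subseq_uniq _ uiA) // map_subseq // filter_subseq.
Qed.

End GridFunctions.

(** * Binomial coefficients modulo a prime and indicators of residue classes *)

Section BinomialsModP.
Variable p : nat.
Hypothesis p_prime : prime p.

(** With [q = p ^ v], use [i * 'C(q, i) = q * 'C(q.-1, i.-1)]: if [p] did not divide the binomial,
    [q] would divide [i]. *)
Lemma dvdn_bin_prime_pow v i : (0 < i < p ^ v)%N -> (p %| 'C(p ^ v, i))%N.
Proof.
case: i => // i /= iq; apply: contraLR iq => pC; rewrite -leqNgt dvdn_leq //.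
rewrite -(@Gauss_dvdl _ _ 'C(p ^ v, i.+1)); last by rewrite coprimeXl // prime_coprime.
by rewrite -mul_bin_diag dvdn_mulr.
Qed.

(** In the Vandermonde expansion every term but the first has a factor ['C(p ^ v, i)] with
    [0 < i < p ^ v], which vanishes modulo [p]. *)
Lemma bin_periodic v y k : (k < p ^ v)%N ->
  'C(y + p ^ v, k)%:R = 'C(y, k)%:R :> 'F_p.
Proof.
move=> kq; rewrite addnC -binomial.Vandermonde big_ord_recl bin0 mul1n subn0 natrD natr_sum.
rewrite big1 ?addr0 // => i _; rewrite natrM.
have /eqP -> : ('C(p ^ v, lift ord0 i)%:R == 0 :> 'F_p).
  rewrite -(dvdn_pcharf (pchar_Fp p_prime)) dvdn_bin_prime_pow //= /bump /=.
  by rewrite add1n (leq_ltn_trans _ kq).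
by rewrite mul0r.
Qed.

(** Periodicity reduces [m] to its remainder, for which the binomial is 0 unless the remainder is
    the top one. *)
Lemma bin_pred_prime_pow v m :
  'C(m, (p ^ v).-1)%:R = (m %% p ^ v == (p ^ v).-1)%N%:R :> 'F_p.
Proof.
have q0 : (0 < p ^ v)%N by rewrite expn_gt0 prime_gt0.
rewrite [in LHS](divn_eq m (p ^ v)); elim: (m %/ p ^ v)%N => [|t IH].
  rewrite add0n; case: eqP => [->|/eqP ne]; first by rewrite binn.
  by rewrite bin_small // ltn_neqAle ne -ltnS prednK // ltn_mod.
by rewrite mulSn -addnA addnC bin_periodic ?IH // prednK.
Qed.

(** The falling factorial is a polynomial of degree [l], and the factorial of [l] is invertible
    because [l < p]. *)
Lemma bin_horner l : (l < p)%N ->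
  exists2 P : {poly 'F_p}, (size P <= l.+1)%N &
    forall m, 'C(m, l)%:R = P.[m%:R].
Proof.
move=> lp; exists ((l`!%:R)^-1 *: \prod_(i <- iota 0 l) ('X - (i%:R)%:P)).
  by rewrite (leq_trans (size_scale_leq _ _)) // size_prod_XsubC size_iota.
move=> m; have l0 : (l`!%:R != 0 :> 'F_p).
  rewrite -(dvdn_pcharf (pchar_Fp p_prime)); elim: l lp => [|l IH] lp.
    by rewrite fact0 dvdn1 neq_ltn prime_gt1 ?orbT.
  by rewrite factS Euclid_dvdM // negb_or IH ?(ltnW lp) // andbT gtnNdvd.
apply: (mulIf l0); rewrite -natrM bin_ffact hornerZ mulrAC mulVf // mul1r.
elim: {lp l0} l => [|l IH]; first by rewrite big_nil hornerC.
rewrite ffactnSr natrM IH -[l.+1]addn1 iotaD big_cat big_seq1 hornerM hornerXsubC add0n.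
(* For [m < l] the truncated difference is not the difference in the field, but the preceding
   product is already 0. *)
case: (leqP l m) => lm; first by rewrite natrB.
by rewrite -IH ffact_small // !mul0r.
Qed.

Lemma size_uniq_Fp (s : seq 'F_p) : uniq s -> (size s <= p)%N.
Proof. by move/card_uniqP <-; rewrite (leq_trans (max_card _)) ?card_Fp. Qed.

(* [h y = \sum_b w_b [y = b mod q]], and [[y = b mod q]] is the reduction mod [p]
   of ['C(y + (q - 1 - b), q - 1)], whose Vandermonde expansion gives the [c k];
   with Lagrange weights [w_b] the coefficients [c k] vanish for
   [k > q - size bs]. *)
Lemma residue_indicator v (bs : seq nat) :
  let q := (p ^ v)%N in
  all (fun b => b < q)%N bs -> uniq (map (fun b => b%:R : 'F_p) bs) -> bs != [::] ->
  exists c : nat -> 'F_p, forall y : nat,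
    (\sum_(k < (q - size bs).+1) c k * 'C(y, k)%:R != 0) = (y %% q \in bs)%N.
Proof.
move=> q /allP bq ubs bs0.
have q0 : (0 < q)%N by rewrite expn_gt0 prime_gt0.
have ub : uniq bs := map_uniq ubs.
have sp : (size bs <= p)%N by rewrite -(size_map (fun b => b%:R : 'F_p)) size_uniq_Fp.
have sbs : (0 < size bs)%N by case: (bs) bs0.
have sq : (size bs <= q)%N.
  by rewrite -(size_iota 0 q) uniq_leq_size // => b /bq; rewrite mem_iota.
(* Adding [q.-1 - b] moves the residue [b] to [q.-1], the one that [bin_pred_prime_pow] detects;
   these shifts are the nodes. *)
pose beta b : 'F_p := (q.-1 - b)%:R.
have betaE : {in bs, forall b, beta b = (q.-1)%:R - b%:R}.
  by move=> b /bq bltq; rewrite /beta natrB // -ltnS prednK.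
have ubeta : uniq (map beta bs).
  have -> : map beta bs = [seq (q.-1)%:R - x | x <- [seq m%:R | m <- bs]].
    by rewrite -map_comp; apply/eq_in_map.
  by rewrite map_inj_uniq // => x x' /addrI /oppr_inj.
pose w b := lagrange_weight (map beta bs) (beta b).
pose c k := \sum_(b <- bs) w b * 'C(q.-1 - b, q.-1 - k)%:R.
exists c => y.
have -> : \sum_(k < (q - size bs).+1) c k * 'C(y, k)%:R
        = \sum_(b <- bs) w b * (y %% q == b)%N%:R.
  transitivity (\sum_(k < q.-1.+1) c k * 'C(y, k)%:R).
    have le : (q - size bs < q.-1.+1)%N by rewrite prednK //; lia.
    rewrite (big_ord_widen _ (fun k => c k * 'C(y, k)%:R) le) big_mkcond.
    apply: eq_bigr => k _; case: ltnP => //= kq.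
    (* Here [q.-1 - k <= size bs - 2], so the binomials in [c k] are values at the nodes of a
       polynomial of size below [size bs], which the Lagrange weights annihilate. *)
    have lp : (q.-1 - k < p)%N by lia.
    have [P sP PE] := bin_horner _ lp.
    have -> : c k = \sum_(x <- map beta bs) P.[x] * lagrange_weight (map beta bs) x.
      by rewrite big_map; apply: eq_bigr => b _; rewrite PE mulrC.
    rewrite sum_lagrange_weight ?mul0r // size_map (leq_ltn_trans sP) //.
    have := ltn_ord k; lia.
  under eq_bigr => k _ do rewrite mulr_suml.
  rewrite exchange_big /=; apply: eq_big_seq => b /bq bltq.
  under eq_bigr => k _ do rewrite -mulrA [_%:R * _]mulrC -natrM.
  rewrite -mulr_sumr -natr_sum binomial.Vandermonde bin_pred_prime_pow -/q; congr (_ * _%:R).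
  congr nat_of_bool.
  rewrite -modnDml; have := ltn_pmod y q0; set r := (y %% q)%N => rq.
  (* Without wraparound the sum is [q.-1] only for [r = b]; with it the remainder is [r - b.+1],
     below [q.-1]. *)
  case: (leqP r b) => rb; first by rewrite modn_small; lia.
  have -> : (r + (q.-1 - b) = r - b.+1 + q)%N by lia.
  rewrite modnDr modn_small; lia.
case: (boolP (y %% q \in bs)%N) => yb.
  rewrite (bigD1_seq _ yb ub) //= eqxx mulr1 big1 ?addr0.
    exact: lagrange_weight_neq0.
  by move=> b /negbTE; rewrite eq_sym => ->; rewrite mulr0.
rewrite big1_seq ?eqxx // => b /= bb; case: eqP => [e|_]; last by rewrite mulr0.
by rewrite e bb in yb.
Qed.

Context {T : eqType} (b : T -> nat).
Let iota (a : T) : 'F_p := (b a)%:R.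

(** Vandermonde splits off a factor ['C(b a, j)] for the first selected coordinate. It has degree at
    most [j]: for [j < p] by [bin_horner], and for [j >= p] because [A] has at most [p] elements, so
    that interpolation on it has degree below [p]. *)
Lemma deg_le_bin_sum (As : seq (seq T)) (e : seq bool) k :
  all uniq As -> {in As, forall A, {in A &, injective iota}} ->
  deg_le iota As k (fun x => 'C(sumn (mask e (map b x)), k)%:R).
Proof.
elim: As e k => // A As IH e k; rewrite [all _ _]/= => /andP[uA uAs] injAs.
have injA : {in A &, injective iota} by apply: injAs; rewrite mem_head.
have {}injAs : {in As, forall A, {in A &, injective iota}}.
  by move=> A' A'As; apply: injAs; rewrite inE A'As orbT.
(* The mask is exhausted, selects the first coordinate, or skips it. *)
case: e => [|[] e].
- apply: (deg_le_ext iota _ _ (fun=> 'C(0, k)%:R * 1)).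
    by move=> x _; rewrite mulr1.
  exact: deg_leZ _ _ _ _ _ (deg_leW _ _ _ _ _ (leq0n k) (deg_le1 iota _)).
- apply: (deg_le_ext iota _ _ (fun x => \sum_(j < k.+1)
    if x is a :: x' then 'C(b a, j)%:R * 'C(sumn (mask e (map b x')), k - j)%:R else 0)).
    move=> x /allpairsP[[a x'] /= [_ _ ->]] /=.
    by rewrite -binomial.Vandermonde natr_sum; apply: eq_bigr => j _; rewrite natrM.
  apply: deg_le_sum => j _; have jk : (j <= k)%N by rewrite -ltnS.
  have [P sP PE] : exists2 P : {poly 'F_p}, (size P <= j.+1)%N &
      {in A, forall a, 'C(b a, j)%:R = P.[iota a]}.
    case: (ltnP j p) => jp.
      by have [P sP PE] := bin_horner _ jp; exists P => // a _; rewrite PE.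
    have [P sP PE] := interpolation iota A (fun a => 'C(b a, j)%:R) uA injA.
    exists P => [|a /PE //]; rewrite (leq_trans sP) // -(size_map iota).
    by rewrite leqW // (leq_trans _ jp) // size_uniq_Fp // map_inj_in_uniq.
  rewrite -[in deg_le _ _ k](subnKC jk).
  exact: (deg_le_cons iota A As _ _ (fun a => 'C(b a, j)%:R) _ P sP PE
    (IH e (k - j)%N uAs injAs)).
- apply: (deg_le_ext iota _ _ (fun x =>
    if x is a :: x' then 1 * 'C(sumn (mask e (map b x')), k)%:R else 0)).
    by move=> x /allpairsP[[a x'] /= [_ _ ->]] /=; rewrite mul1r.
  apply: (deg_le_cons iota A As 0 k (fun=> 1) _ 1); rewrite ?size_poly1 //.
    by move=> a _; rewrite hornerC.
  exact: IH.
Qed.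

(** A form of Warning's second theorem with restricted variables and conditions modulo powers of
    [p]; the mask [e j] selects the variables of condition [j]. *)
Lemma warning_restricted (J : finType) (As : seq (seq T)) (v : J -> nat)
    (bs : J -> seq nat) (e : J -> seq bool) :
  all uniq As -> {in As, forall A, {in A &, injective iota}} ->
  (forall j, all (fun m => m < p ^ v j)%N (bs j)) ->
  (forall j, uniq (map (fun m => m%:R : 'F_p) (bs j))) ->
  (forall j, bs j != [::]) ->
  let sol x := [forall j, sumn (mask (e j) (map b x)) %% p ^ v j \in bs j]%N in
  has sol (grid As) ->
  exists y : seq nat,
    [/\ all2 (fun k A => 0 < k <= size A)%N y As,
        (sumn (map size As) <= sumn y + \sum_j (p ^ v j - size (bs j)))%N
      & (\prod_(k <- y) k <= count sol (grid As))%N].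
Proof.
move=> uAs injAs bsq ubs bs0 sol.
have /fin_all_exists[c cE] j := residue_indicator (v j) (bs j) (bsq j) (ubs j) (bs0 j).
pose f x : 'F_p := \prod_j
  \sum_(k < (p ^ v j - size (bs j)).+1) c j k * 'C(sumn (mask (e j) (map b x)), k)%:R.
have solE : sol =1 (fun x => f x != 0).
  move=> x; rewrite /f prodf_seq_neq0; apply/forallP/allP => [xs j _|xs j].
    by rewrite /= cE.
  by rewrite -cE; exact: xs (mem_index_enum j).
rewrite (eq_has solE) (eq_count solE); apply: (alon_furedi iota) => //.
apply: (deg_le_prod iota As _ _ (fun j x => \sum_(k < (p ^ v j - size (bs j)).+1)
  c j k * 'C(sumn (mask (e j) (map b x)), k)%:R) _ (deg_le1 iota As)) => j; apply: deg_le_sum => k _.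
by apply: deg_leZ; apply: deg_leW (deg_le_bin_sum _ _ _ uAs injAs); rewrite -ltnS.
Qed.

End BinomialsModP.

(** * Lowering a vector to a prescribed sum *)

(** While the sum exceeds [M >= n], some entry exceeds 1 and can be lowered by one. *)
Lemma sum_ord_lower (n : nat) (y : 'I_n -> nat) (M : nat) :
  (forall i, 0 < y i)%N -> (n <= M <= \sum_i y i)%N ->
  exists2 z : 'I_n -> nat, (forall i, 0 < z i <= y i)%N & (\sum_i z i)%N = M.
Proof.
move=> y0 /andP[nM]; have [k] := ubnP (\sum_i y i - M)%N.
elim: k y y0 => // k IH y y0 yk My.
move: My; rewrite leq_eqVlt => /predU1P[->|Mlt].
  by exists y => // i; rewrite y0 leqnn.
have /existsP[i yi] : [exists i, 1 < y i]%N.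
  apply: contraTT Mlt => /existsPn y1; rewrite -leqNgt (leq_trans _ nM) //.
  rewrite -[leqRHS]card_ord -sum1_card leq_sum // => i _; rewrite leqNgt; exact: y1.
pose y' j := (y j - (j == i))%N.
have y'E : (\sum_j y j = (\sum_j y' j).+1)%N.
  rewrite (bigD1 i) //= [in RHS](bigD1 i) //= /y' eqxx -addSn; congr (_ + _)%N; first lia.
  by apply: eq_bigr => j /negbTE ->; rewrite subn0.
have y'0 j : (0 < y' j)%N.
  by rewrite /y'; case: eqP => [->|_]; have := y0 j; lia.
have y'k : (\sum_j y' j - M < k)%N by lia.
have y'M : (M <= \sum_j y' j)%N by lia.
have [z zy' zM] := IH y' y'0 y'k y'M.
by exists z => // j; have := zy' j; rewrite /y'; lia.
Qed.

Lemma bigminn_le {I : eqType} (x : nat) (r : seq I) (P : pred I) (f : I -> nat) i :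
  i \in r -> P i -> (\big[minn/x]_(j <- r | P j) f j <= f i)%N.
Proof.
move=> + Pi; elim: r => // k r IH; rewrite inE big_cons => /predU1P[<-|/IH].
  by rewrite Pi geq_minl.
by case: ifP => // _ le; rewrite (leq_trans (geq_minr _ _)).
Qed.

(** The sum provided by [alon_furedi] may exceed [N]; lowering the entries until it equals [N] only
    decreases the product and yields a competitor for the minimum. *)
Lemma minprod_le (n : nat) (a y : 'I_n -> nat) (N : int) :
  (forall i, 0 < y i <= a i)%N -> N <= \sum_i (y i)%:Z ->
  (minprod a N <= \prod_i y i)%N.
Proof.
move=> ya; rewrite -(big_morph _ PoszD (erefl _)) /minprod => Ny.
have y0 i : (0 < y i)%N by case/andP: (ya i).
case: ltP => [_|nN]; first by rewrite prodn_gt0.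
case: N nN Ny => // M; rewrite !lez_nat => nM My.
have [|z zy zM] := sum_ord_lower n y M y0; first by rewrite nM My.
have za i : (z i < (a i).+1)%N by have := zy i; have := ya i; lia.
pose u : {dffun forall i : 'I_n, 'I_(a i).+1} := [ffun i => Ordinal (za i)].
have uE i : u i = z i :> nat by rewrite ffunE.
apply: (@leq_trans (\prod_i u i)%N).
  apply: bigminn_le; first exact: mem_index_enum.
  apply/andP; split; first by apply/forallP => i; rewrite uE; case/andP: (zy i).
  by rewrite -(big_morph _ PoszD (erefl _)) eqz_nat (eq_bigr _ (fun i _ => uE i)) zM.
rewrite (eq_bigr _ (fun i _ => uE i)); apply: leq_prod => i _.
by case/andP: (zy i).
Qed.

(** * Encoding integer weightings as grid points *)

(** Lets natural remainders replace integer weights in any ring where [d] vanishes; it serves both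
    ['F_p] and ['Z_(q j)]. *)
Lemma natr_absz_modz {R : pzRingType} (d : nat) (a : int) :
  (0 < d)%N -> d%:R = 0 :> R -> `|(a %% d)%Z|%N%:R = a%:~R :> R.
Proof.
move=> d0 dR; have dZ : d%:Z != 0 by rewrite eqz_nat -lt0n.
rewrite pmulrn gez0_abs ?modz_ge0 //.
rewrite [in RHS](divz_eq a d) [RHS]intrD intrM.
by rewrite -[(d%:Z)%:~R]pmulrn dR mulr0 add0r.
Qed.

Lemma intr_Fp_inj (p : nat) (a c : int) : prime p ->
  a%:~R = c%:~R :> 'F_p -> (a = c %[mod p])%Z.
Proof.
move=> pp ac; have p0 := prime_gt0 pp.
have := ac; rewrite -(natr_absz_modz p a p0 (pchar_Fp_0 pp)).
rewrite -(natr_absz_modz p c p0 (pchar_Fp_0 pp)) => /(congr1 val).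
have p0' : p%:Z != 0 by rewrite eqz_nat -lt0n.
have lt m : (`|(m %% p)%Z| < p)%N by rewrite -ltz_nat gez0_abs ?modz_ge0 // ltz_pmod.
rewrite /= !(val_Fp_nat pp) !modn_small // => e.
by rewrite -[LHS]gez0_abs ?modz_ge0 // e gez0_abs ?modz_ge0.
Qed.

(** Carries [warning_restricted] over to the graph. The vector [y] is kept because the two claims of
    (c) exploit it differently: one through [minprod], the other through an entry above 1. *)
Lemma count_divisible (r n p : nat) (q : 'I_r.+1 -> nat) (A : nat -> {fset int})
    (B : forall j : 'I_r.+1, {set 'Z_(q j)}) (G : graph 'I_r.+1 'I_n)
    (v : 'I_r.+1 -> nat) :
  (forall j, 1 < q j)%N ->
  (forall j k : 'I_r.+1, (j <= k)%N -> (q j %| q k)%N) ->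
  (forall j, B j != set0) -> prime p -> (forall j, q j = p ^ v j)%N ->
  (forall i : 'I_n, {in A i &, forall x y, (x = y %[mod p%:Z])%Z -> x = y}) ->
  (forall j, {in B j &, forall x y : 'Z_(q j), x = y %[mod p] -> x = y}) ->
  (exists a : weighting n A, divisible B G a) ->
  exists y : 'I_n -> nat,
    [/\ forall i, (0 < y i <= #|` A i|)%N,
        (\sum_(i < n) #|` A i| <= \sum_i y i + \sum_j (q j - #|B j|))%N
      & (\prod_i y i <= #|[set a : weighting n A | divisible B G a]|)%N].
Proof.
move=> q1 qdvd B0 pp qE Amod Bmod [a0 a0B].
(* The last modulus is a multiple of every [q j] and of [p], so the remainder modulo [M] represents
   a weight in all these rings at once. *)
set M := q ord_max; have M0 : (0 < M)%N by apply: ltnW; exact: q1.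
have MZ j : M%:R = 0 :> 'Z_(q j).
  have /dvdnP[k ->] : (q j %| M)%N by apply: qdvd; exact: leq_ord.
  by rewrite natrM pchar_Zp ?mulr0.
have MF : M%:R = 0 :> 'F_p.
  apply/eqP; rewrite -(dvdn_pcharf (pchar_Fp pp)).
  have := q1 ord_max; rewrite /M qE; case: (v _) => // k _; exact: dvdn_exp.
pose b (a : int) : nat := `|(a %% M)%Z|%N.
pose As : seq (seq int) := [seq enum_fset (A (nat_of_ord i)) | i <- enum 'I_n].
pose bs j := [seq nat_of_ord x | x <- enum (B j)].
pose e j := [seq incident G j i | i <- enum 'I_n].
pose xs (a : weighting n A) := [seq weight a i | i <- enum 'I_n].
have AsE (i : 'I_n) : nth [::] As i = A i.
  by rewrite (nth_map i) ?size_enum_ord // nth_ord_enum.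
have sAs : size As = n by rewrite size_map size_enum_ord.
have uAs : all uniq As by apply/allP => _ /mapP[i _ ->]; exact: fset_uniq.
have injAs : {in As, forall A, {in A &, injective (fun a => (b a)%:R : 'F_p)}}.
  move=> _ /mapP[i _ ->] x y xA yA; rewrite /b !natr_absz_modz // => /(intr_Fp_inj _ _ _ pp).
  exact: (Amod i _ _ xA yA).
have bsq j : all (fun m => m < p ^ v j)%N (bs j).
  by apply/allP => _ /mapP[x _ ->]; rewrite -qE -[ltnRHS]Zp_cast.
have ubs j : uniq [seq (m%:R : 'F_p) | m <- bs j].
  rewrite -map_comp map_inj_in_uniq ?enum_uniq // => x y; rewrite !mem_enum => xB yB /=.
  by move/(congr1 val); rewrite /= !(val_Fp_nat pp); exact: Bmod.
have sbs j : size (bs j) = #|B j| by rewrite size_map -cardE.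
have bs0 j : bs j != [::] by rewrite -size_eq0 sbs cards_eq0.
have := warning_restricted p pp b 'I_r.+1 As v bs e uAs injAs bsq ubs bs0.
set sol := fun x => _; move=> /= warn.
have solE a : sol (xs a) = divisible B G a.
  rewrite /sol /divisible; apply: eq_forallb => j.
  have -> : sumn (mask (e j) (map b (xs a))) =
      (\sum_(i < n | incident G j i) b (weight a i))%N.
    rewrite -map_comp -map_mask -filter_mask sumnE big_map big_filter.
    by rewrite big_enum_cond.
  rewrite -qE -(val_Zp_nat (q1 j)) mem_map ?mem_enum; last exact: val_inj.
  suff -> : (\sum_(i < n | incident G j i) b (weight a i))%:R
      = (wdeg G a j)%:~R :> 'Z_(q j) by [].
  rewrite natr_sum /wdeg rmorph_sum /=.
  by apply: eq_bigr => i _; apply: (natr_absz_modz M _ M0 (MZ j)).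
have xs_grid a : xs a \in grid As.
  apply/(mem_grid _ _ 0); rewrite size_map sAs size_enum_ord; split=> // i iltn.
  rewrite (AsE (Ordinal iltn)) (nth_map (Ordinal iltn)) ?size_enum_ord //.
  by rewrite (nth_ord_enum (Ordinal iltn) (Ordinal iltn)); exact: fsvalP.
have grid_xs x : x \in grid As -> exists a, xs a = x.
  move=> /(mem_grid _ _ 0)[]; rewrite sAs => sx xA.
  have xA' (i : 'I_n) : nth 0 x i \in A i by have := xA i; rewrite AsE; exact.
  exists [ffun i => [` xA' i]%fset]; apply: (@eq_from_nth _ 0).
    by rewrite size_map size_enum_ord.
  move=> i; rewrite size_map size_enum_ord => iltn.
  rewrite (nth_map (Ordinal iltn)) ?size_enum_ord // /weight ffunE /=.
  by rewrite nth_enum_ord.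
have [|y [yAs ys yP]] := warn.
  by apply/hasP; exists (xs a0); rewrite ?solE.
move: yAs; rewrite all2E sAs => /andP[/eqP sy /allP yA].
exists (fun i => nth 0%N y i); split.
- move=> i; have := yA (nth 0%N y i, nth [::] As i); rewrite AsE; apply.
  by rewrite -AsE -nth_zip ?sy ?sAs // mem_nth // size_zip sy sAs minnn.
- move: ys; rewrite /As -map_comp !sumnE big_map big_enum (big_nth 0%N) sy big_mkord /=.
  move=> /leq_trans; apply; rewrite leq_add2l.
  by apply: leq_sum => j _; rewrite -qE sbs.
have -> : (\prod_(i < n) nth 0 y i = \prod_(k <- y) k)%N.
  by rewrite (big_nth 0%N) sy big_mkord.
(* The grid has no repetitions, and each solution in it is the image under [xs] of a divisible
   weighting. *)
apply: (leq_trans yP); rewrite -size_filter cardE -(size_map xs).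
apply: uniq_leq_size; first by rewrite filter_uniq // uniq_grid.
move=> x; rewrite mem_filter => /andP[solx /grid_xs[a xE]].
by rewrite -xE map_f // mem_enum inE -solE xE.
Qed.

(** * Weighted sums of incidence vectors, and assembly of the theorem *)

Lemma Gq_sumE (r : nat) (q : 'I_r -> nat) (I : Type) (s : seq I) (P : pred I)
    (x : I -> Gq q) j : (\sum_(i <- s | P i) x i) j = \sum_(i <- s | P i) x i j.
Proof. by apply: (big_morph (fun y : Gq q => y j)) => [y z|]; rewrite ffunE. Qed.

Lemma Gq_mulrzE (r : nat) (q : 'I_r -> nat) (x : Gq q) (m : int) j :
  (x *~ m) j = x j *~ m.
Proof.
have natE k : (x *+ k) j = x j *+ k.
  by elim: k => [|k IH]; rewrite ?mulrS ffunE // IH.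
by case: m => k; rewrite ?NegzE ?mulrNz ?ffunE -!pmulrn natE.
Qed.

(** Edge [i] contributes its weight to coordinate [j] exactly when it meets [j], so that coordinate
    is the weighted degree. *)
Lemma wsum_incidence (r n : nat) (q : 'I_r -> nat) (A : nat -> {fset int})
    (B : forall j : 'I_r, {set 'Z_(q j)}) (G : graph 'I_r 'I_n) (a : weighting n A) :
  (wsum (incidence q G) a \in Gq_prod B) = divisible B G a.
Proof.
rewrite inE; apply: eq_forallb => j.
suff -> : wsum (incidence q G) a j = (wdeg G a j)%:~R by [].
rewrite Gq_sumE /wdeg rmorph_sum [RHS]big_mkcond /=; apply: eq_bigr => i _.
by rewrite Gq_mulrzE ffunE; case: incident; rewrite ?mul0rz.
Qed.

(* There are r.+1 vertices and moduli; ord0 is the first, ord_max the last. *)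
Theorem theorem3p17 (r n : nat) (q : 'I_r.+1 -> nat) (A : nat -> {fset int})
    (B : forall j : 'I_r.+1, {set 'Z_(q j)}) (G : graph 'I_r.+1 'I_n)
    (hn : (0 < n)%N)
    (hq1 : forall j, (1 < q j)%N)
    (hqdvd : forall j k : 'I_r.+1, (j <= k)%N -> (q j %| q k)%N)
    (hpgrp : exists2 p : nat, prime p & (p.-group [set: Gq q])%g)
    (hA : forall i, A i != fset0)
    (hB : forall j, B j != set0) :
  [/\ (* (a) *)
      #|[set a : weighting n A | divisible B G a]|
        = Ncount A (Gq_prod B) (incidence q G),
      (* (b) *)
      (forall i, 0 \in A i) ->
      (forall i, exists2 x, x \in A i & ~~ ((q ord_max)%:Z %| x)%Z) ->
      (forall j, 0 \in B j) ->
      forall D : nat, is_fat_davenport A (Gq_prod B) (Gq' q) D ->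
      (D <= n)%N ->
      exists2 a : weighting n A, nonempty_weighting a & divisible B G a
    & (* (c) *)
      forall (p : nat) (v : 'I_r.+1 -> nat),
      prime p ->
      (forall j, (1 <= v j)%N) ->
      (forall j k : 'I_r.+1, (j <= k)%N -> (v j <= v k)%N) ->
      (forall j, q j = p ^ v j)%N ->
      (forall i : 'I_n, {in A i &, forall x y, (x = y %[mod p%:Z])%Z -> x = y}) ->
      (forall j, {in B j &, forall x y : 'Z_(q j), x = y %[mod p] -> x = y}) ->
      (* (i) *)
      (#|[set a : weighting n A | divisible B G a]| = 0%N \/
       (minprod (fun i : 'I_n => #|` A i|)
          (\sum_(i < n) (#|` A i|)%:Z - \sum_j ((p ^ v j)%:Z - #|B j|%:Z))
        <= #|[set a : weighting n A | divisible B G a]|)%N) /\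
      (* (ii) *)
      ((forall i : 'I_n, 0 \in A i) -> (forall j, 0 \in B j) ->
       \sum_j ((p ^ v j)%:Z - #|B j|%:Z) < \sum_(i < n) ((#|` A i|)%:Z - 1) ->
       exists2 a : weighting n A, nonempty_weighting a & divisible B G a)].
Proof.
split.
- by apply: eq_card => a; rewrite [LHS]inE [RHS]inE wsum_incidence.
- move=> A0 _ B0 D [D0 HD _] Dn.
  have [|a a0 aB] := HD (fun i => incidence q G (widen_ord Dn i)).
    by move=> i; exact: incidence_in_Gq'.
  (* The weighting obtained on the first [D] edges is extended by weight 0 to the others. *)
  have extA (i : 'I_n) : (if insub (i : nat) is Some k then weight a k else 0) \in A i.
    by case: insubP => [k _ <-|_]; [exact: fsvalP | exact: A0].
  pose ext : weighting n A := [ffun i => [` extA i]%fset].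
  have extE k : weight ext (widen_ord Dn k) = weight a k.
    by rewrite /weight ffunE /= valK.
  exists ext.
    by have /existsP[k ak] := a0; apply/existsP; exists (widen_ord Dn k); rewrite extE.
  rewrite -wsum_incidence /wsum (bigID (fun i : 'I_n => i < D)%N) /= big_ord_narrow.
  rewrite [X in _ + X]big1 ?addr0 => [|i iD].
    by under eq_bigr => k _ do rewrite extE.
  by rewrite /weight ffunE /= insubF ?mulr0z //; apply/negbTE.
move=> p v pp v1 vle qE Amod Bmod.
(* Thanks to this bound the truncated differences in [count_divisible] agree with the integer ones
   in the statement. *)
have Bq j : (#|B j| <= q j)%N.
  by apply: (leq_trans (max_card _)); rewrite card_ord Zp_cast.
have count := count_divisible r n p q A B G v hq1 hqdvd hB pp qE Amod Bmod.
have defectE : \sum_j ((p ^ v j)%:Z - #|B j|%:Z) = (\sum_j (q j - #|B j|))%N.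
  rewrite (big_morph _ PoszD (erefl _)); apply: eq_bigr => j _.
  by rewrite -qE subzn.
split.
- case: (posnP #|[set a : weighting n A | divisible B G a]|) => [->|]; first by left.
  case/card_gt0P => a0; rewrite inE => a0B; right.
  have [y [yA ys yP]] := count (ex_intro _ a0 a0B).
  apply: leq_trans yP; apply: minprod_le => //.
  by rewrite defectE -!(big_morph _ PoszD (erefl _)) lerBlDr -PoszD lez_nat.
- move=> A0 B0; rewrite defectE => lt.
  (* The zero weighting is divisible, so the count is positive and the lower bound applies. *)
  pose a0 : weighting n A := [ffun i => [` A0 i]%fset].
  have a0B : divisible B G a0.
    apply/forallP => j; rewrite /wdeg big1 => [|i _]; first exact: B0.
    by rewrite /weight ffunE.
  have [y [yA ys yP]] := count (ex_intro _ a0 a0B).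
  (* Otherwise the entries of [y] sum to at most [n], against the strict inequality. An entry above
     1 makes the product at least 2, and one of two distinct divisible weightings differs from
     [a0]. *)
  have /existsP[i yi] : [exists i, 1 < y i]%N.
    apply: contraTT lt => /existsPn y1; rewrite -leNgt.
    have le : (\sum_i y i <= n)%N.
      rewrite -[leqRHS]card_ord -sum1_card leq_sum // => i _; rewrite leqNgt; exact: y1.
    rewrite sumrB -(big_morph _ PoszD (erefl _)) sumr_const card_ord natz.
    by rewrite lerBlDr -PoszD lez_nat (leq_trans ys) // addnC leq_add2l.
  have /card_gt1P[b [c [bB cB bc]]] : (1 < #|[set a : weighting n A | divisible B G a]|)%N.
    apply: leq_trans yP; rewrite (bigD1 i) //= (leq_trans yi) // leq_pmulr //.
    by rewrite prodn_gt0 // => k; case/andP: (yA k).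
  have nz (d : weighting n A) : d != a0 -> nonempty_weighting d.
    apply: contraR => /existsPn d0; apply/eqP/ffunP => k; apply: val_inj.
    by rewrite ffunE /=; have /negPn/eqP := d0 k.
  rewrite !inE in bB cB.
  have [ba|ba] := eqVneq b a0; last by exists b; rewrite ?nz.
  by exists c; rewrite ?nz // -ba eq_sym.
Qed.
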